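(* Let $\mathcal{A}$ be a unital C$^*$-algebra faithfully represented on a Hilbert space, with Riemann sphere $\mathcal{R}$. Let $\tilde p\in\mathcal{R}$ satisfy $\|[\tilde p_0,\tilde p]\|<1/2$, and let $X=\begin{pmatrix} 0 & a^* \\ a & 0 \end{pmatrix}\in(T\mathcal{R})_{\tilde p_0}$, $a\in\mathcal{A}$, with $\|X\|<\pi/4$ and $\operatorname{Exp}_{\tilde p_0}(X)=\tilde p$ (that is, $X=\operatorname{Log}_{\tilde p_0}(\tilde p)$). Let $a=v|a|$ be the polar decomposition of $a$. Then $\tilde p$ lies in the domain $\mathcal{V}_0$ of the chart $\varphi_0$ and $$\varphi_0(\tilde p)=v\tan(|a|).$$
   Context: $\mathcal{U}_2$ is the unitary group of $M_2(\mathcal{A})$, $\tilde p_0=\begin{pmatrix} 1 & 0 \\ 0 & 0 \end{pmatrix}$, $\mathbf{e}_1=\begin{pmatrix} 1 \\ 0 \end{pmatrix}$, $\mathcal{R}=\{\tilde u\tilde p_0\tilde u^*:\tilde u\in\mathcal{U}_2\}$, $\mathcal{K}=\{\tilde u\mathbf{e}_1:\tilde u\in\mathcal{U}_2\}\subset\mathcal{A}^2$. The tangent space $(T\mathcal{R})_{\tilde p_0}$ consists of the self-adjoint co-diagonal matrices $X=\begin{pmatrix} 0 & a^* \\ a & 0 \end{pmatrix}$, $a\in\mathcal{A}$. The exponential map is $\operatorname{Exp}_{\tilde p_0}(X)=e^{\tilde X}\tilde p_0e^{-\tilde X}$ with $\tilde X=[X,\tilde p_0]=X\tilde p_0-\tilde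 p_0X$; $\operatorname{Log}_{\tilde p_0}$ denotes its inverse with values in $\{X\in(T\mathcal{R})_{\tilde p_0}:\|X\|<\pi/4\}$. The principal chart is $\varphi_0:\mathcal{V}_0\to\mathcal{A}$, where $\mathcal{V}_0=\{\mathbf{x}\mathbf{x}^*:\mathbf{x}=\begin{pmatrix} x_1 \\ x_2 \end{pmatrix}\in\mathcal{K},\ x_1\text{ invertible}\}\subset\mathcal{R}$ and $\varphi_0(\mathbf{x}\mathbf{x}^* )=x_2x_1^{-1}$ (well defined). $|a|=(a^*a)^{1/2}$; the polar decomposition is taken in the given representation, so $v$ is a partial isometry. *)

(* Defs.v *)
From HB Require Import structures.
From mathcomp Require Import all_boot all_order all_algebra.
From mathcomp Require Import sesquilinear complex.
From mathcomp Require Import all_classical all_reals all_analysis.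

Set Implicit Arguments.
Unset Strict Implicit.
Unset Printing Implicit Defensive.

Import Order.TTheory GRing.Theory Num.Theory.
Import numFieldNormedType.Exports.

Local Open Scope classical_set_scope.
Local Open Scope ring_scope.
Local Open Scope complex_scope.

(* The norm is not taken from [completeNormedModType R[i]]: Hierarchy-Builder
   refuses a common extension of normed modules and unit rings that is not
   below [numDomainType], so the Banach space axioms are spelled out here. *)
HB.mixin Record isCStarAlgebra (R : realType) A & GRing.UnitAlgebra R[i] A := {
  cnorm : A -> R ;
  cnorm0_eq0 : forall x : A, cnorm x = 0 -> x = 0 ;
  cnormD : forall x y : A, cnorm (x + y) <= cnorm x + cnorm y ;
  cnormZ : forall (l : R[i]) (x : A), cnorm (l *: x) = complex.Re `|l| * cnorm x ;
  cnormM : forall x y : A, cnorm (x * y) <= cnorm x * cnorm y ;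
  cnorm_complete : forall u : nat -> A,
    (forall e : R, 0 < e ->
      exists N, forall m n, (N <= m)%N -> (N <= n)%N -> cnorm (u m - u n) < e) ->
    exists l : A, (fun n => cnorm (u n - l)) @ \oo --> (0 : R) ;
  star : A -> A ;
  starK : involutive star ;
  starD : {morph star : x y / x + y} ;
  starZ : forall (l : R[i]) (x : A), star (l *: x) = Num.conj l *: star x ;
  starM : forall x y : A, star (x * y) = star y * star x ;
  cnorm_starM : forall x : A, cnorm (star x * x) = cnorm x ^+ 2
}.

#[short(type="cstarAlgType")]
HB.structure Definition CStarAlgebra (R : realType) :=
  {A of GRing.UnitAlgebra R[i] A & isCStarAlgebra R A}.

Section cstar.
Context {R : realType} {A : cstarAlgType R}.
Implicit Types (a b : A) (X p u : 'M[A]_2) (x : 'cV[A]_2).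

Definition spectrum b : set R[i] := [set l | l%:A - b \isn't a GRing.unit].

(* In [R[i]], [0 <= l] says that [l] is a nonnegative real number. *)
Definition positive b : Prop := star b = b /\ spectrum b `<=` [set l | 0 <= l].

(* [b = |a| = (a^* a)^(1/2)]: the positive square root is unique *)
Definition is_modulus a b : Prop := positive b /\ b ^+ 2 = star a * a.

Definition cstar_lim (s : nat -> A) : A :=
  xget 0 [set l | (fun n => cnorm (s n - l)) @ \oo --> (0 : R)].

(* The functional calculus for the sum of an everywhere convergent power series
   with coefficients [c]; [tan] is the quotient of [sin] by [cos], the latter
   being invertible on elements of spectrum inside [`]-pi/2, pi/2[]. *)
Definition entire_calculus (c : R^nat) b : A :=
  cstar_lim (series (fun n => (c n)%:C *: b ^+ n)).

Definition sinA b : A := entire_calculus (sin_coeff 1) b.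
Definition cosA b : A := entire_calculus (cos_coeff 1) b.
Definition tanA b : A := sinA b / cosA b.

Definition adjmx m n (M : 'M[A]_(m, n)) : 'M[A]_(n, m) := map_mx star M^T.

(* the norm [|x^* x|^(1/2)] of the Hilbert module [A^2] *)
Definition cvnorm x : R :=
  Num.sqrt (cnorm ((adjmx x *m x) ord0 ord0)).

(* The C*-norm of [M_2(A)], as the operator norm on the Hilbert module [A^2].
   It is always finite; the supremum is taken in [\bar R] because that of an
   unbounded set of reals would be a junk value. *)
Definition mxopnorm X : \bar R :=
  ereal_sup [set (cvnorm (X *m x))%:E | x in [set x | cvnorm x <= 1]].

(* Convergence for the C*-norm of [M_2(A)] is entrywise convergence. *)
Definition expmx X : 'M[A]_2 :=
  \matrix_(i, j) cstar_lim (fun N =>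
    series (fun n => ((exp_coeff 1 n : R)%:C%:A : A) *: X ^+ n) N i j).

Definition commutator X p : 'M[A]_2 := X * p - p * X.

Definition U2 : set 'M[A]_2 := [set u | adjmx u * u = 1 /\ u * adjmx u = 1].

Definition p0 : 'M[A]_2 := delta_mx ord0 ord0.
Definition e1 : 'cV[A]_2 := delta_mx ord0 ord0.

Definition sphere : set 'M[A]_2 := [set u * p0 * adjmx u | u in U2].
Definition K2 : set 'cV[A]_2 := [set u *m e1 | u in U2].

Definition codiag a : 'M[A]_2 :=
  block_mx (0 : 'M[A]_1) (star a)%:M a%:M (0 : 'M[A]_1).

Definition Exp_p0 X : 'M[A]_2 :=
  expmx (commutator X p0) * p0 * expmx (- commutator X p0).

Definition chart_rep p x : Prop :=
  [/\ K2 x, x ord0 ord0 \is a GRing.unit & p = x *m adjmx x].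

Definition V0 : set 'M[A]_2 := [set p | exists x, chart_rep p x].

Definition phi0 p : A :=
  let x := xget 0 [set x | chart_rep p x] in x ord_max ord0 / x ord0 ord0.

Lemma adjmx_mul m n k (M : 'M[A]_(m, n)) (N : 'M[A]_(n, k)) :
  adjmx (M *m N) = adjmx N *m adjmx M.
Proof.
have star0 : star (0 : A) = 0 by apply: (addrI (star 0)); rewrite -starD !addr0.
apply/matrixP => i j; rewrite !mxE (big_morph star (@starD _ _) star0).
by apply: eq_bigr => l _; rewrite starM !mxE.
Qed.

Lemma K2_adj x : K2 x -> adjmx x *m x = 1.
Proof.
have star0 : star (0 : A) = 0 by apply: (addrI (star 0)); rewrite -starD !addr0.
have star1 : star (1 : A) = 1.
  by rewrite -[LHS]mul1r -[X in X * _]starK -starM mul1r starK.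
move=> [u [uu _] <-]; rewrite adjmx_mul mulmxA -(mulmxA _ _ u).
rewrite [adjmx u *m u]uu mulmx1; apply/matrixP => i j; rewrite !ord1 !mxE.
by rewrite !big_ord_recl big_ord0 !mxE /= star0 star1 mul0r !addr0 mul1r.
Qed.

(* [phi0] does not depend on the representative *)
Lemma phi0_rep p x : chart_rep p x -> phi0 p = x ord_max ord0 / x ord0 ord0.
Proof.
move=> px; rewrite /phi0; have := @xgetPex _ 0 [set x | chart_rep p x] (ex_intro _ x px).
set y := xget _ _ => /= -[Ky Uy py]; case: px => Kx Ux px.
have xy : x = y *m (adjmx y *m x).
  by rewrite mulmxA -py px -mulmxA (K2_adj Kx) mulmx1.
have E i : x i ord0 = y i ord0 * (adjmx y *m x) ord0 ord0.
  by rewrite {1}xy mxE big_ord1.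
have Uc : (adjmx y *m x) ord0 ord0 \is a GRing.unit.
  by rewrite -(unitrMr _ Uy) -E.
by rewrite !E invrM // mulrA mulrK.
Qed.

End cstar.

Arguments U2 {R} A.
Arguments p0 {R} A.
Arguments e1 {R} A.
Arguments sphere {R} A.
Arguments K2 {R} A.
Arguments V0 {R} A.

Section representation.
Context {R : realType} {H : completeNormedModType R[i]}.
Variable ip : {dot H for @Num.conj R[i]}.

Definition hilbert_dot : Prop := forall xi : H, ip xi xi = `|xi| ^+ 2.

Definition partial_isometry (v : {linear H -> H}) : Prop :=
  continuous v /\
  forall xi, (forall eta, v eta = 0 -> ip xi eta = 0) -> `|v xi| = `|xi|.

Context {A : cstarAlgType R}.

Record faithful_representation (pi : A -> {linear H -> H}) : Prop := {
  rep_bounded : forall a, continuous (pi a) ;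
  repD : forall a b xi, pi (a + b) xi = pi a xi + pi b xi ;
  repZ : forall (l : R[i]) a xi, pi (l *: a) xi = l *: pi a xi ;
  repM : forall a b xi, pi (a * b) xi = pi a (pi b xi) ;
  rep1 : forall xi, pi 1 xi = xi ;
  rep_star : forall a xi eta, ip (pi (star a) xi) eta = ip xi (pi a eta) ;
  rep_inj : forall a b, pi a =1 pi b -> a = b
}.

Definition polar_decomposition (pi : A -> {linear H -> H}) a
    (v : {linear H -> H}) absa : Prop :=
  [/\ is_modulus a absa,
      partial_isometry v,
      (forall xi, pi a xi = v (pi absa xi))
    & (forall xi, v xi = 0 <-> pi a xi = 0)].

End representation.

(* Main.v *)
(* Put b = |a| and T = [X, p0]. The first column of T^n only involves powers of
   b^2 = a^* a, so the first column of e^T is x = (cos b, a s), where s is the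
   sum of the power series of sin(b)/b; in particular b s = sin b. As T^* = - T,
   the first row of e^(-T) is x^*, whence p = x x^*.
   Since |b| = |a| <= |X| < 1, we have |1 - cos b| <= |b|^2 < 1 and the Neumann
   series inverts cos b. Then p^2 = p forces x^* x = 1, by cancelling the
   invertible first entry of x; comparing x with a vector u e_1 such that
   p = (u e_1)(u e_1)^* shows that the two differ by a unitary of A on the
   right, so x is in K and phi_0(p) = a s (cos b)^-1. Finally a = v b in the
   representation turns a s (cos b)^-1 into v b s (cos b)^-1 = v tan b. *)
From HB Require Import structures.
From mathcomp Require Import all_boot all_order all_algebra.
From mathcomp Require Import sesquilinear complex.
From mathcomp Require Import all_classical all_reals all_analysis.
From mathcomp Require Import lra.
Require Import Defs.

Import Order.TTheory GRing.Theory Num.Theory.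
Import numFieldNormedType.Exports.

Local Open Scope classical_set_scope.
Local Open Scope ring_scope.
Local Open Scope complex_scope.

(** * Norm and limits in a C*-algebra; dominated series and the Neumann series *)

Section CStarNorm.
Context {R : realType} {A : cstarAlgType R}.
Implicit Types (x y l k : A) (s : nat -> A).

Lemma Re_normC (r : R) : complex.Re `|r%:C| = `|r|.
Proof. by rewrite normc_def /= expr0n /= addr0 sqrtr_sqr. Qed.

Lemma cnormZr (r : R) x : cnorm (r%:C *: x) = `|r| * cnorm x.
Proof. by rewrite cnormZ Re_normC. Qed.

Lemma cnorm0 : cnorm (0 : A) = 0.
Proof. by rewrite -(scale0r (0 : A)) cnormZ normr0 mul0r. Qed.

Lemma cnormN x : cnorm (- x) = cnorm x.
Proof. by rewrite -scaleN1r cnormZ normrN normr1 mul1r. Qed.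

Lemma cnorm_ge0 x : 0 <= cnorm x.
Proof.
have := cnormD x (- x); rewrite subrr cnorm0 cnormN -mulr2n.
by rewrite pmulrn_lge0.
Qed.

Lemma cnormBC x y : cnorm (x - y) = cnorm (y - x).
Proof. by rewrite -cnormN opprB. Qed.

Lemma cnorm_sum (u : nat -> A) (m n : nat) :
  cnorm (\sum_(m <= i < n) u i) <= \sum_(m <= i < n) cnorm (u i).
Proof.
elim/big_ind2 : _ => //; first by rewrite cnorm0.
by move=> x1 x2 y1 y2 h1 h2; rewrite (le_trans (cnormD _ _))// lerD.
Qed.

Lemma star1 : star (1 : A) = 1.
Proof. by rewrite -[LHS]mul1r -[X in X * _]starK -starM mul1r starK. Qed.

(** The C*-identity gives $|1| = |1|^2$, so $|1|$ is 0 or 1. *)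
Lemma cnorm1_le1 : cnorm (1 : A) <= 1.
Proof.
have := cnorm_starM (1 : A); rewrite star1 mulr1 => /eqP.
rewrite expr2 -subr_eq0 -{1}[cnorm 1]mulr1 -mulrBr mulf_eq0 subr_eq0.
by case/orP => /eqP h; rewrite ?h // -h.
Qed.

Lemma cnormX x n : cnorm (x ^+ n) <= cnorm x ^+ n.
Proof.
elim: n => [|n IH]; first by rewrite !expr0 cnorm1_le1.
by rewrite !exprS (le_trans (cnormM _ _))// ler_wpM2l ?cnorm_ge0.
Qed.

(** Cancelling in $|y|^2 = |y^* y| \le |y^*| |y|$ gives $|y| \le |y^*|$, used for both $x$ and its
    adjoint. *)
Lemma cnorm_star x : cnorm (star x) = cnorm x.
Proof.
have le (y : A) : cnorm y <= cnorm (star y).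
  have := cnormM (star y) y; rewrite cnorm_starM expr2.
  have := cnorm_ge0 y; rewrite le_eqVlt => /orP[/eqP <- _|y0].
    exact: cnorm_ge0.
  by rewrite ler_pM2r.
by apply/eqP; rewrite eq_le -{2}(starK x) !le.
Qed.

Lemma star0 : star (0 : A) = 0.
Proof. by apply: (addrI (star 0)); rewrite -starD !addr0. Qed.

Lemma starN x : star (- x) = - star x.
Proof. by apply: (addrI (star x)); rewrite -starD !subrr star0. Qed.

Lemma star_unit x : x \is a GRing.unit -> star x \is a GRing.unit.
Proof.
move=> /unitrP[y [yx xy]]; apply/unitrP; exists (star y).
by rewrite -!starM yx xy star1.
Qed.

Definition clim s l : Prop := (fun n => cnorm (s n - l)) @ \oo --> (0 : R).

Lemma clim_squeeze s l (w : R^nat) :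
  (forall n, cnorm (s n - l) <= w n) -> w @ \oo --> (0 : R) -> clim s l.
Proof.
move=> le_w w0; apply: (@squeeze_cvgr _ _ _ _ (fun=> 0) w) => //.
- by near=> n; rewrite cnorm_ge0 le_w.
- exact: cvg_cst.
Unshelve. all: by end_near. Qed.

Lemma clim_unique s l k : clim s l -> clim s k -> l = k.
Proof.
move=> sl sk; apply/eqP; rewrite -subr_eq0; apply/eqP/cnorm0_eq0/eqP.
have /= sum0 : (fun n => cnorm (s n - l) + cnorm (s n - k)) @ \oo --> (0 : R).
  by rewrite -(addr0 (0 : R)); apply: cvgD.
rewrite eq_le cnorm_ge0 andbT -(cvg_lim (@Rhausdorff R) sum0).
apply: limr_ge; first exact: cvgP sum0.
near=> n; rewrite /= [X in _ <= X + _]cnormBC.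
by rewrite (le_trans _ (cnormD _ _))// subrKA.
Unshelve. all: by end_near. Qed.

(** [cstar_lim] selects some limit, or 0 if there is none; uniqueness identifies the choice. *)
Lemma cstar_limE s l : clim s l -> cstar_lim s = l.
Proof.
move=> sl; apply: (@clim_unique s) => //.
exact: (@xgetPex _ 0 [set k | clim s k] (ex_intro _ l sl)).
Qed.

Lemma clim_mull x s l : clim s l -> clim (fun n => x * s n) (x * l).
Proof.
move=> sl; apply: (@clim_squeeze _ _ (fun n => cnorm x * cnorm (s n - l))).
  by move=> n; rewrite -mulrBr cnormM.
by rewrite -(mulr0 (cnorm x)); apply: cvgMr.
Qed.

Lemma clim_mulr x s l : clim s l -> clim (fun n => s n * x) (l * x).
Proof.
move=> sl; apply: (@clim_squeeze _ _ (fun n => cnorm (s n - l) * cnorm x)).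
  by move=> n; rewrite -mulrBl cnormM.
by rewrite -(mul0r (cnorm x)); apply: cvgMl.
Qed.

Lemma clim_star s l : clim s l -> clim (star \o s) (star l).
Proof.
rewrite /clim (_ : (fun n => _) = (fun n => cnorm ((star \o s) n - star l))) //.
by apply/funext => n; rewrite /= -starN -starD cnorm_star.
Qed.

Lemma clim_shiftS s l : clim (fun n => s n.+1) l = clim s l.
Proof. by rewrite /clim -[RHS]cvg_shiftS. Qed.

Lemma clim_le s l k (M : R) :
  (forall n, cnorm (s n - k) <= M) -> clim s l -> cnorm (l - k) <= M.
Proof.
move=> sM sl; rewrite -subr_le0.
rewrite -(cvg_lim (@Rhausdorff R) sl); apply: limr_ge; first exact: cvgP sl.
near=> n; rewrite lerBlDr -(subrKA (s n)) (le_trans (cnormD _ _))//.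
by rewrite cnormBC lerD2l.
Unshelve. all: by end_near. Qed.

(** Weierstrass M-test: domination makes the partial sums Cauchy, and completeness supplies the
    limit. *)
Lemma clim_series_dominated (u : nat -> A) (w : R^nat) :
  (forall n, cnorm (u n) <= w n) -> cvgn (series w) ->
  exists l, clim (series u) l.
Proof.
move=> uw /cauchy_cvgP/cauchy_seriesP cw; apply: cnorm_complete => e e0.
have [[P Q] /= [[N1 _ PN] [N2 _ QN] PQ]] := cw _ e0.
exists (maxn N1 N2) => m n; rewrite !geq_max => /andP[m1 m2] /andP[n1 n2].
wlog mn : m n m1 m2 n1 n2 / (m <= n)%N.
  move=> h; have [?|/ltnW ?] := leqP m n; first exact: h.
  by rewrite cnormBC h.
rewrite cnormBC sub_series_geq// (le_lt_trans (cnorm_sum _ _ _))//.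
apply: le_lt_trans (PQ (m, n) _) => /=; last by split; [exact: PN|exact: QN].
by rewrite (le_trans _ (ler_norm _))// ler_sum.
Qed.

Lemma entire_calculus_cvg (c : R^nat) x :
  (forall n, `|c n| <= (n`!%:R)^-1) ->
  exists l, clim (series (fun n => (c n)%:C *: x ^+ n)) l.
Proof.
move=> hc; apply: (@clim_series_dominated _ (exp_coeff (cnorm x))).
  move=> n; rewrite cnormZr /exp_coeff /= mulrC.
  by rewrite ler_pM ?cnorm_ge0 ?cnormX.
exact: is_cvg_series_exp_coeff.
Qed.

(** With $y = 1 - x$, the product of $x$ and $\sum_{i<n} y^i$ telescopes to $1 - y^n$, which tends
    to 1. *)
Lemma neumann_unit x : cnorm (1 - x) < 1 -> x \is a GRing.unit.
Proof.
move=> x1; set y := 1 - x; have xE : x = 1 - y by rewrite opprB addrC subrK.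
have [l sl] : exists l, clim (series (fun n => y ^+ n)) l.
  apply: (@clim_series_dominated _ (geometric 1 (cnorm y))).
    by move=> n /=; rewrite mul1r cnormX.
  by apply: is_cvg_geometric_series; rewrite ger0_norm ?cnorm_ge0.
have l1 : clim (fun n => x * series (fun n => y ^+ n) n) 1.
  apply: (@clim_squeeze _ _ (geometric 1 (cnorm y))).
    move=> n; rewrite /= mul1r seriesEord /= xE -(opprB y 1) mulNr -subrX1.
    by rewrite opprB addrAC subrr sub0r cnormN cnormX.
  by apply: cvg_geometric; rewrite ger0_norm ?cnorm_ge0.
(* Each partial sum commutes with [x], so the right inverse [l] is also a left inverse. *)
have l2 : clim (fun n => series (fun n => y ^+ n) n * x) 1.
  rewrite (_ : (fun n => _) = fun n => x * series (fun n => y ^+ n) n) //.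
  apply/funext => n; rewrite /series /= mulr_sumr mulr_suml.
  apply: eq_bigr => i _; rewrite xE mulrBl mulrBr mul1r mulr1.
  by rewrite -exprS -exprSr.
apply/unitrP; exists l.
by rewrite (clim_unique _ _ _ (clim_mull x _ _ sl) l1)
           (clim_unique _ _ _ (clim_mulr x _ _ sl) l2).
Qed.

End CStarNorm.

(** * Entries of the matrix exponential; power series of sine and cosine *)

Section Exponential.
Context {R : realType} {A : cstarAlgType R}.
Implicit Types (a b : A) (p u X : 'M[A]_2) (x y : 'cV[A]_2).

Lemma forall_ord2 (P : 'I_2 -> Prop) : P ord0 -> P ord_max -> forall i, P i.
Proof.
move=> P0 P1 [[|[|//]] hi].
- by rewrite (_ : Ordinal hi = ord0)//; apply/val_inj.
- by rewrite (_ : Ordinal hi = ord_max)//; apply/val_inj.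
Qed.

Lemma mulmx2E (m n : nat) (M : 'M[A]_(m, 2)) (N : 'M[A]_(2, n)) i j :
  (M *m N) i j = M i ord0 * N ord0 j + M i ord_max * N ord_max j.
Proof.
rewrite mxE !big_ord_recl big_ord0 addr0.
by rewrite (_ : lift ord0 ord0 = ord_max)//; apply/val_inj.
Qed.

Lemma p0E i j : p0 A i j = ((i == ord0) && (j == ord0))%:R.
Proof. by rewrite mxE. Qed.

Lemma codiagE a : ((codiag a ord0 ord0 = 0) * (codiag a ord0 ord_max = star a) *
  (codiag a ord_max ord0 = a) * (codiag a ord_max ord_max = 0))%type.
Proof.
rewrite /codiag; do !split; rewrite !mxE;
  by do 2 (case: splitP => -[[|//] ?] //= _; rewrite !mxE).
Qed.

Lemma commutator_p0 a i j : commutator (codiag a) (p0 A) i j =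
  if i == ord0 then if j == ord0 then 0 else - star a
  else if j == ord0 then a else 0.
Proof.
rewrite /commutator [LHS]mxE [X in _ + X]mxE !mulmx2E !p0E.
move: i j; apply: forall_ord2; apply: forall_ord2; rewrite !codiagE /=;
  by rewrite !(mulr0, mul0r, mulr1, mul1r, addr0, add0r, oppr0).
Qed.

Lemma adjmxE m n (M : 'M[A]_(m, n)) i j : adjmx M i j = star (M j i).
Proof. by rewrite !mxE. Qed.

Lemma adjmx_commutator a :
  adjmx (commutator (codiag a) (p0 A)) = - commutator (codiag a) (p0 A).
Proof.
apply/matrixP => i j; rewrite adjmxE [RHS]mxE !commutator_p0.
move: i j; apply: forall_ord2; apply: forall_ord2;
  by rewrite /= ?star0 ?starN ?starK ?oppr0 ?opprK.
Qed.

Lemma adjmxX X n : adjmx (X ^+ n) = adjmx X ^+ n.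
Proof.
elim: n => [|n IH].
  apply/matrixP => i j; rewrite adjmxE !expr0 !mxE eq_sym.
  by case: (i == j); rewrite ?star0 ?star1.
by rewrite exprS exprSr -IH; apply: adjmx_mul.
Qed.

Lemma expmx_entry X i j l :
  clim (series (fun n => (exp_coeff 1 n)%:C *: (X ^+ n) i j)) l ->
  expmx X i j = l.
Proof.
move=> h; rewrite mxE; apply: cstar_limE; congr clim: h.
apply/funext => N; rewrite /series /= summxE; apply: eq_bigr => n _.
by rewrite [RHS]mxE mulr_algl.
Qed.

(** The involution is isometric and the coefficients are real, so the adjoint passes through the
    series term by term. *)
Lemma expmx_adjmx_entry X i j l :
  clim (series (fun n => (exp_coeff 1 n)%:C *: (X ^+ n) i j)) l ->
  expmx (adjmx X) j i = star l.
Proof.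
move=> /clim_star h; apply: expmx_entry; congr clim: h.
apply/funext => N; rewrite /series /= (big_morph star (@starD _ _) star0).
apply: eq_bigr => n _; rewrite starZ -adjmxX adjmxE; congr (_ *: _).
by apply: conj_Creal; rewrite complex_real.
Qed.

Lemma sin_coeff_le n : `|@sin_coeff R 1 n| <= (n`!%:R)^-1.
Proof.
rewrite /sin_coeff /= expr1n mulr1 normrM normrM normrX normrN1 expr1n mulr1.
rewrite ger0_norm // ger0_norm ?invr_ge0 // ler_piMl ?invr_ge0 //.
by case: odd.
Qed.

Lemma cos_coeff_le n : `|@cos_coeff R 1 n| <= (n`!%:R)^-1.
Proof.
rewrite /cos_coeff /= expr1n mulr1 -exprnP normrM normrM normrX normrN1 expr1n.
rewrite mulr1 ger0_norm // ger0_norm ?invr_ge0 // ler_piMl ?invr_ge0 //.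
by case: odd.
Qed.

Lemma entire_calculus_clim (c : R^nat) b :
  (forall n, `|c n| <= (n`!%:R)^-1) ->
  clim (series (fun n => (c n)%:C *: b ^+ n)) (entire_calculus c b).
Proof.
move=> /(@entire_calculus_cvg _ _ c b)[l h].
by rewrite /entire_calculus (cstar_limE _ _ h).
Qed.

(* The series of sin(b)/b, meaningful also when b is not invertible. *)
Definition sincA b : A := entire_calculus (fun n => sin_coeff 1 n.+1) b.

Lemma sincA_clim b :
  clim (series (fun n => (@sin_coeff R 1 n.+1)%:C *: b ^+ n)) (sincA b).
Proof.
(* The shifted coefficients still satisfy the required bound, as $1/(n+1)! \le 1/n!$. *)
apply: entire_calculus_clim => n; rewrite (le_trans (sin_coeff_le _)) //.
by rewrite lef_pV2 ?posrE ?ltr0n ?fact_gt0 // ler_nat factS leq_pmull.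
Qed.

(** The constant coefficient of sine vanishes, so $b$ factors out of the series. *)
Lemma sinA_sincA b : sinA b = b * sincA b.
Proof.
apply: cstar_limE; rewrite -clim_shiftS; have := clim_mull b _ _ (sincA_clim b).
congr clim; apply/funext => N.
rewrite /series /= big_nat_recl //= mulr_sumr.
rewrite (sin_coeff_even 0) scale0r add0r; apply: eq_bigr => n _.
by rewrite exprS scalerAr.
Qed.

Lemma cosA_unit b : cnorm b < 1 -> cosA b \is a GRing.unit.
Proof.
move=> b1; apply: neumann_unit; rewrite cnormBC.
apply: le_lt_trans (_ : cnorm b ^+ 2 < 1); last first.
  by rewrite exprn_ilt1 ?cnorm_ge0.
set S := series (fun n => (@cos_coeff R 1 n)%:C *: b ^+ n).
(* As 2^(n+1) <= (n+2)! and cnorm b <= 1, the term of index n + 2 is at most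
   cnorm b ^+ 2 / 2^(n+1). *)
have bound N : cnorm (S N.+2 - 1) <= cnorm b ^+ 2 * (1 - 2^-1 ^+ N).
  elim: N => [|N IH].
    (* For $N = 0$ the sum has the terms of index 0 and 1 only, equal to 1 and 0. *)
    rewrite /S /series /= big_nat_recr // big_nat_recr // big_geq //.
    rewrite {1}/cos_coeff /= add0r {1}/cos_coeff /= ?mul0r !mul1r invr1 expr0.
    by rewrite scale1r scale0r addr0 !subrr cnorm0 mulr0.
  rewrite /S /series /= big_nat_recr //= addrAC (le_trans (cnormD _ _)) //.
  apply: (@le_trans _ _
    (cnorm b ^+ 2 * (1 - 2^-1 ^+ N) + cnorm b ^+ 2 * 2^-1 ^+ N.+1)).
    apply: lerD => //; rewrite cnormZr mulrC ler_pM ?cnorm_ge0 //.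
      rewrite (le_trans (cnormX _ _)) // -addn2 exprD.
      rewrite ler_piMl ?exprn_ge0 ?cnorm_ge0 //.
      by rewrite exprn_ile1 ?cnorm_ge0 ?ltW.
    rewrite (le_trans (cos_coeff_le _)) // exprVn.
    rewrite lef_pV2 ?posrE ?ltr0n ?fact_gt0 ?exprn_gt0 //.
    rewrite -natrX ler_nat; elim: N {IH} => // N IH.
    by rewrite expnS factS leq_mul.
  rewrite -mulrDr ler_wpM2l ?exprn_ge0 ?cnorm_ge0 //.
  by rewrite exprS; lra.
(* The bound $|b|^2 (1 - 2^{-N}) \le |b|^2$ is uniform in $N$ and survives the limit. *)
apply: (@clim_le _ _ (fun N => S N.+2)).
  move=> N; apply: (le_trans (bound N)).
  by rewrite ler_piMr ?exprn_ge0 ?cnorm_ge0.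
by have := entire_calculus_clim _ b cos_coeff_le; rewrite -2!clim_shiftS.
Qed.

End Exponential.

(** * Exponential of a tangent vector; vectors representing points of the sphere *)

Section Sphere.
Context {R : realType} {A : cstarAlgType R}.
Implicit Types (a b : A) (p u X : 'M[A]_2) (x y : 'cV[A]_2).

Lemma mulmx11E (m n : nat) (M : 'M[A]_(m, 1)) (N : 'M[A]_(1, n)) i j :
  (M *m N) i j = M i ord0 * N ord0 j.
Proof. by rewrite mxE big_ord1. Qed.

Lemma commutatorX_col0 a b k : b ^+ 2 = star a * a ->
  let T := commutator (codiag a) (p0 A) in
  [/\ (T ^+ k.*2) ord0 ord0 = ((-1) ^+ k)%:C *: b ^+ k.*2,
      (T ^+ k.*2) ord_max ord0 = 0,
      (T ^+ k.*2.+1) ord0 ord0 = 0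
    & (T ^+ k.*2.+1) ord_max ord0 = ((-1) ^+ k)%:C *: (a * b ^+ k.*2)].
Proof.
move=> hb T.
have T0 n : (T ^+ n.+1) ord0 ord0 = - star a * (T ^+ n) ord_max ord0.
  by rewrite exprS [LHS]mulmx2E !commutator_p0 /= mul0r add0r.
have T1 n : (T ^+ n.+1) ord_max ord0 = a * (T ^+ n) ord0 ord0.
  by rewrite exprS [LHS]mulmx2E !commutator_p0 /= mul0r addr0.
elim: k => [|k [_ _ o0 o1]].
  by rewrite double0 T0 T1 !expr0 !mxE /= mulr0 scale1r mulr1 scale1r.
have e0 : (T ^+ k.+1.*2) ord0 ord0 = ((-1) ^+ k.+1)%:C *: b ^+ k.+1.*2.
  rewrite doubleS T0 o1 mulNr -scalerAr mulrA -hb -exprD add2n.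
  by rewrite [in RHS]exprS mulN1r rmorphN scaleNr.
have e1 : (T ^+ k.+1.*2) ord_max ord0 = 0 by rewrite doubleS T1 o0 mulr0.
split=> //; first by rewrite T0 e1 mulr0.
by rewrite T1 e0 -scalerAr.
Qed.

Lemma expmx_commutator_col0 a b : b ^+ 2 = star a * a ->
  let T := commutator (codiag a) (p0 A) in
  let E i := series (fun n => (@exp_coeff R 1 n)%:C *: (T ^+ n) i ord0) in
  clim (E ord0) (cosA b) /\ clim (E ord_max) (a * sincA b).
Proof.
move=> hb T E.
(* Both parities in one formula, shaped like [cos_coeff] and [sin_coeff]; at $n = 0$ the truncated
   [n.-1] is harmless, its factor being 0. *)
have TE n : (T ^+ n) ord0 ord0 =
      ((~~ odd n)%:R * (-1) ^+ n./2)%:C *: b ^+ n /\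
    (T ^+ n) ord_max ord0 =
      ((odd n)%:R * (-1) ^+ n.-1./2)%:C *: (a * b ^+ n.-1).
  rewrite -(odd_double_half n) /T.
  have [e0 e1 o0 o1] := commutatorX_col0 _ _ (n./2) hb.
  case: (odd n); rewrite ?add0n ?add1n /= ?odd_double /= ?doubleK;
    by rewrite ?mul0r ?mul1r ?scale0r; split.
split.
  have := entire_calculus_clim _ b cos_coeff_le; congr clim.
  apply/funext => N; rewrite /E /series /=; apply: eq_bigr => n _.
  rewrite (TE n).1 scalerA -rmorphM; congr (_%:C *: _).
  by rewrite /cos_coeff /exp_coeff /= expr1n mulr1 mul1r [RHS]mulrC.
rewrite -clim_shiftS; have := clim_mull a _ _ (sincA_clim b); congr clim.
apply/funext => N; rewrite /E /series /= big_nat_recl // mulr_sumr.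
rewrite (TE 0%N).2 /= mul0r scale0r scaler0 add0r; apply: eq_bigr => n _.
rewrite (TE n.+1).2 scalerA -rmorphM -scalerAr; congr (_%:C *: _).
by rewrite /sin_coeff /exp_coeff /= expr1n mulr1 mul1r [RHS]mulrC.
Qed.

(** Multiplying by $p_0$ in the middle keeps only the first column of $e^T$ and the first row of
    $e^{-T}$, its adjoint. *)
Lemma Exp_p0_codiag a b : b ^+ 2 = star a * a ->
  let x := \col_i (if i == ord0 then cosA b else a * sincA b) in
  Exp_p0 (codiag a) = x *m adjmx x.
Proof.
move=> hb x; have [c0 c1] := expmx_commutator_col0 _ _ hb.
rewrite /Exp_p0 -adjmx_commutator; set T := commutator _ _ in c0 c1 *.
have l i : expmx T i ord0 = x i ord0.
  by move: i; apply: forall_ord2; rewrite [x _ _]mxE /=; apply: expmx_entry.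
have r j : expmx (adjmx T) ord0 j = star (x j ord0).
  move: j; apply: forall_ord2; rewrite [x _ _]mxE /=;
    exact: expmx_adjmx_entry.
apply/matrixP => i j; rewrite mulmx11E adjmxE.
rewrite [LHS]mulmx2E [X in X * _ + _]mulmx2E [X in _ + X * _]mulmx2E !p0E /=.
by rewrite l r !mulr0 mulr1 !addr0 mul0r addr0.
Qed.

Lemma sphere_idem p : sphere A p -> p * p = p.
Proof.
move=> [u [uu _] <-]; rewrite !mulrA -(mulrA _ (adjmx u)) uu mulr1.
by rewrite -(mulrA u); congr (u * _ * _); apply: mul_delta_mx.
Qed.

(** Multiplying a unitary $u$ by $\mathrm{diag}(c, 1)$ on the right turns its first column $y$ into
    $y c$. *)
Lemma diag_unitary (c : A) : star c * c = 1 -> c * star c = 1 ->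
  let D : 'M[A]_2 :=
    \matrix_(i, j) (if i == j then if i == ord0 then c else 1 else 0) in
  U2 A D.
Proof.
move=> cc1 cc2 D.
split; apply/matrixP => i j; rewrite [LHS]mulmx2E !adjmxE !mxE;
  by move: i j; apply: forall_ord2; apply: forall_ord2;
    rewrite /= ?star1 ?star0 ?(mulr0, mul0r, mulr1, addr0, add0r).
Qed.

Lemma adjmxK x : adjmx (adjmx x) = x.
Proof. by apply/matrixP => i j; rewrite !adjmxE starK. Qed.

Lemma U2_mul u X : U2 A u -> U2 A X -> U2 A (u * X).
Proof.
move=> [u1 u2] [X1 X2]; split.
  by rewrite [adjmx _]adjmx_mul [LHS]mulrA -(mulrA (adjmx X)) u1 mulr1.
by rewrite [adjmx _]adjmx_mul [LHS]mulrA -(mulrA u) X2 mulr1.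
Qed.

Lemma col2_eq x y : x ord0 ord0 = y ord0 ord0 ->
  x ord_max ord0 = y ord_max ord0 -> x = y.
Proof.
move=> h0 h1; apply/matrixP => i j; rewrite ord1.
by move: i; apply: forall_ord2.
Qed.

Lemma scalar_mx1_inj : injective (fun c : A => c%:M : 'M[A]_1).
Proof. by move=> c d /matrixP/(_ ord0 ord0); rewrite !mxE. Qed.

Lemma mx11E (M : 'M[A]_1) : M = (M ord0 ord0)%:M.
Proof. by apply/matrixP => i j; rewrite !ord1 !mxE. Qed.

Lemma adjmx_scalar1 (c : A) : adjmx (c%:M : 'M[A]_1) = (star c)%:M.
Proof. by apply/matrixP => i j; rewrite adjmxE !ord1 !mxE. Qed.

Lemma p0_e1 : p0 A = e1 A *m adjmx (e1 A).
Proof.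
apply/matrixP => i j; rewrite mulmx11E adjmxE p0E !mxE.
by case: (i == _); case: (j == _); rewrite ?star0 ?star1 ?mulr1 ?mulr0.
Qed.

Lemma sphere_rep p x : sphere A p -> p = x *m adjmx x ->
  x ord0 ord0 \is a GRing.unit -> K2 A x.
Proof.
move=> sp px x0u.
have xx : adjmx x *m x = 1.
  have [w wE] : exists w, w = adjmx x *m x by exists (adjmx x *m x).
  (* This is $p^2 = p$; its top left entry is $x_1 w x_1^* = x_1 x_1^*$, where both outer factors
     can be cancelled. *)
  have /matrixP/(_ ord0 ord0) : x *m (w *m adjmx x) = x *m adjmx x.
    by rewrite wE mulmxA (mulmxA x) -mulmxA -px; apply: sphere_idem.
  rewrite !mulmx11E adjmxE.
  move=> /(mulrI x0u) h; rewrite -wE [w]mx11E (_ : w _ _ = 1) //.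
  by apply: (mulIr (star_unit _ x0u)); rewrite h mul1r.
case: sp => u Uu; rewrite p0_e1 => pu.
set y := u *m e1 A; have py : p = y *m adjmx y.
  by rewrite -pu /y adjmx_mul [RHS]mulmxA -(mulmxA u (e1 A)).
have yy : adjmx y *m y = 1 by apply: K2_adj; exists u.
set c := (adjmx y *m x) ord0 ord0.
have cM : adjmx y *m x = c%:M by exact: mx11E.
have cM' : adjmx x *m y = (star c)%:M.
  by rewrite -[y in LHS]adjmxK -adjmx_mul cM adjmx_scalar1.
(* $y c = y y^* x = p x = x x^* x = x$. *)
have xyc : x = y *m c%:M by rewrite -cM mulmxA -py px -mulmxA xx mulmx1.
have cc1 : star c * c = 1.
  apply: scalar_mx1_inj; rewrite scalar_mxM -cM' -cM mulmxA -(mulmxA _ y).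
  by rewrite -py px mulmxA xx mul1mx.
have cc2 : c * star c = 1.
  apply: scalar_mx1_inj; rewrite scalar_mxM -cM' -cM mulmxA -(mulmxA _ x).
  by rewrite -px py mulmxA yy mul1mx.
(* The witness works because $x = u e_1 c = u \, \mathrm{diag}(c, 1) e_1$. *)
exists (u * \matrix_(i, j) (if i == j then if i == ord0 then c else 1 else 0)).
  exact: U2_mul Uu (diag_unitary _ cc1 cc2).
rewrite [RHS]xyc /y -[in RHS]mulmxA -[LHS]mulmxA; congr (_ *m _).
apply: col2_eq; rewrite [LHS]mulmx2E [RHS]mulmx11E !mxE /=;
  by rewrite !(mulr0, mul0r, mulr1, mul1r, addr0).
Qed.

(** Test the operator norm on $e_1$, which is sent to $(0, a)$, of norm $|a^* a|^{1/2} = |a|$. *)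
Lemma codiag_norm_le a : ((cnorm a)%:E <= mxopnorm (codiag a))%E.
Proof.
apply: ereal_sup_ubound; exists (e1 A).
  rewrite /= /cvnorm mulmx2E !adjmxE !mxE /= star0 mul0r addr0 mulr1 star1.
  by rewrite -sqrtr1 ler_sqrt // cnorm1_le1.
congr (_%:E); rewrite /cvnorm mulmx2E !adjmxE.
have -> : (codiag a *m e1 A) ord0 ord0 = 0.
  by rewrite mulmx2E !codiagE !mxE /= mul0r mulr0 addr0.
have -> : (codiag a *m e1 A) ord_max ord0 = a.
  by rewrite mulmx2E !codiagE !mxE /= mulr1 mulr0 addr0.
by rewrite mulr0 add0r cnorm_starM sqrtr_sqr ger0_norm ?cnorm_ge0.
Qed.

Lemma pi_lt4 : (pi / 4 : R) < 1.
Proof. by have := @pihalf_lt2 R; lra. Qed.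

(** $|b|^2 = |b^* b| = |b^2| = |a^* a| = |a|^2$. *)
Lemma cnorm_modulus a b : is_modulus a b -> cnorm b = cnorm a.
Proof.
move=> [[sb _] b2]; apply/eqP; rewrite -(eqrXn2 (n := 2)) ?cnorm_ge0 //.
by rewrite -!cnorm_starM sb -b2 expr2.
Qed.

End Sphere.

(** * The principal chart in terms of the logarithm *)

Theorem theorem4p4 (R : realType) (A : cstarAlgType R)
    (H : completeNormedModType R[i]) (ip : {dot H for @Num.conj R[i]})
    (hip : hilbert_dot ip)
    (rho : A -> {linear H -> H}) (hrho : faithful_representation ip rho)
    (p : 'M[A]_2) (hp : sphere A p)
    (hp_near : (mxopnorm (commutator (p0 A) p) < (2^-1)%:E)%E)
    (a : A) (X : 'M[A]_2) (hX : X = codiag a)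
    (hX_small : (mxopnorm X < (pi / 4)%:E)%E)
    (hexp : Exp_p0 X = p)
    (v : {linear H -> H}) (absa : A)
    (hpolar : polar_decomposition ip rho a v absa) :
  V0 A p /\ forall xi : H, rho (phi0 p) xi = v (rho (tanA absa) xi).
Proof.
have [habs _ rho_a _] := hpolar; have [_ b2] := habs.
have b1 : cnorm absa < 1.
  rewrite (cnorm_modulus _ _ habs) (lt_trans _ (pi_lt4 (R := R))) // -lte_fin.
  by rewrite (le_lt_trans (codiag_norm_le a)) // -hX.
set x : 'cV[A]_2 := \col_i (if i == ord0 then cosA absa else a * sincA absa).
have x0 : x ord0 ord0 = cosA absa by rewrite mxE.
have x1 : x ord_max ord0 = a * sincA absa by rewrite mxE.
have px : chart_rep p x.
  have pE : p = x *m adjmx x by rewrite -hexp hX (Exp_p0_codiag _ _ b2).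
  have x0u : x ord0 ord0 \is a GRing.unit by rewrite x0 cosA_unit.
  by split=> //; apply: sphere_rep hp pE x0u.
split=> [|xi]; first by exists x.
rewrite (phi0_rep px) x0 x1 /tanA sinA_sincA -!mulrA.
(* As $v$ is only an operator on $H$, the factor $a$ is split off inside the representation, where
   it acts as $v$ after $|a|$. *)
by rewrite !(repM hrho _ (_ * _)) rho_a.
Qed.
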